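(* Let $\gamma$ be a cardinal with $\gamma>\aleph_0$, let $G$ be an Abelian group of cardinality $\gamma$, and let $\kappa$ be a cardinal such that $\aleph_0<\kappa\le\gamma$. Then $G$ is $\kappa$-asymorphic to the free Abelian group $A_\gamma$ of rank $\gamma$.
   Context: A ball structure is a triple $\mathcal{B}=(X,P,B)$ where $X,P$ are non-empty sets and, for all $x\in X$ and $\alpha\in P$, $B(x,\alpha)$ is a subset of $X$ with $x\in B(x,\alpha)$ (the ball of radius $\alpha$ around $x$). Put $B^*(x,\alpha)=\{y\in X: x\in B(y,\alpha)\}$ and $B(A,\alpha)=\bigcup_{a\in A}B(a,\alpha)$ for $A\subseteq X$. A ball structure is a ballean if: (i) for any $\alpha,\beta\in P$ there exist $\alpha',\beta'\in P$ such that for every $x\in X$, $B(x,\alpha)\subseteq B^*(x,\alpha')$ and $B^*(x,\beta)\subseteq B(x,\beta')$; (ii) for any $\alpha,\beta\in P$ there exists $\rho\in P$ such that for every $x\in X$, $B(B(x,\alpha),\beta)\subseteq B(x,\rho)$; (iii) for any $x,y\in X$ there exists $\alpha\in P$ with $y\in B(x,\alpha)$. For balleans $\mathcal{B}=(X,P,B)$ and $\mathcal{B}'=(X',P',B')$, a mapping $f:X\to X'$ is a $\prec$-mapping if for every $\alpha\in P$ there exists $\alpha'\in P'$ such that $f(B(x,\alpha))\subseteq B'(f(x),\alpha')$ for every $x\in X$. A bijection $f:X\to X'$ is an asymorphism if both $f$ and $f^{-1}$ are $\prec$-mappings; then $\mathcal{B}$ and $\mathcal{B}'$ are called asymorphic.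 For an infinite group $G$ with identity $e$ and an infinite cardinal $\kappa\le|G|$, let $[G]^{<\kappa}=\{A\subseteq G:|A|<\kappa\}$, and let $(G,[G]^{<\kappa})$ denote the ballean with support $G$, set of radii $[G]^{<\kappa}$, and balls $B(g,A)=(A\cup\{e\})g$. Groups $G$ and $H$ are $\kappa$-asymorphic if the balleans $(G,[G]^{<\kappa})$ and $(H,[H]^{<\kappa})$ are asymorphic. Equivalently, there is a bijection $f:G\to H$ such that for any $X\in[G]^{<\kappa}$ and $Y\in[H]^{<\kappa}$ there exist $X'\in[G]^{<\kappa}$ and $Y'\in[H]^{<\kappa}$ such that for all $x\in G$, $y\in H$: $f(Xx)\subseteq Y'f(x)$ and $f^{-1}(Yy)\subseteq X'f^{-1}(y)$. *)

(* Defs.v *)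
From HB Require Import structures.
From mathcomp Require Import all_boot all_algebra.
From mathcomp Require Import all_classical.
From mathcomp.multinomials Require Export freeg.

Set Implicit Arguments.
Unset Strict Implicit.
Unset Printing Implicit Defensive.

Local Open Scope classical_set_scope.
Local Open Scope card_scope.

Record ballStructure := BallStructure {
  support : Type;
  radii : Type;
  ball : support -> radii -> set support }.

Definition ball_star (B : ballStructure) (x : support B) (a : radii B) :
    set (support B) :=
  [set y | ball y a x].

Definition ball_set (B : ballStructure) (A : set (support B)) (a : radii B) :
    set (support B) :=
  \bigcup_(x in A) ball x a.

Record is_ball_structure (B : ballStructure) : Prop := IsBallStructure {
  support_neq0 : [set: support B] !=set0;
  radii_neq0 : [set: radii B] !=set0;
  ball_center : forall (x : support B) (a : radii B), ball x a x }.

Record is_ballean (B : ballStructure) : Prop := IsBallean {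
  ballean_ball_structure : is_ball_structure B;
  ballean_sym : forall a b : radii B, exists a' b' : radii B,
    forall x : support B,
      ball x a `<=` ball_star x a' /\ ball_star x b `<=` ball x b';
  ballean_mul : forall a b : radii B, exists r : radii B,
    forall x : support B, ball_set (ball x a) b `<=` ball x r;
  ballean_connected : forall x y : support B, exists a : radii B, ball x a y }.

Definition prec_mapping (B B' : ballStructure) (f : support B -> support B') :
    Prop :=
  forall a : radii B, exists a' : radii B',
    forall x : support B, f @` ball x a `<=` ball (f x) a'.

Definition asymorphism (B B' : ballStructure) (f : support B -> support B') :
    Prop :=
  exists g : support B' -> support B,
    [/\ cancel f g, cancel g f, prec_mapping f & prec_mapping g].

Definition asymorphic (B B' : ballStructure) : Prop :=
  exists f : support B -> support B', asymorphism f.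

Definition card_lt (T U : Type) (A : set T) (B : set U) : Prop :=
  A #<= B /\ ~ (B #<= A).

(* A cardinal kappa is represented by a type K with kappa elements; the type  *)
(* below is then the set of all subsets of T of cardinality < kappa.          *)
Definition small_subsets (K T : Type) : Type :=
  {A : set T | card_lt A [set: K]}.

Definition group_ballean (K : Type) (G : groupType) : ballStructure :=
  @BallStructure G (small_subsets K G)
    (fun g A => [set (a * g)%g | a in sval A `|` [set 1%g]]).

(* Meaningful for infinite K with kappa <= |G| and kappa <= |H|; see          *)
(* group_balleanP below for the ballean axioms of the two structures.         *)
Definition kappa_asymorphic (K : Type) (G H : groupType) : Prop :=
  asymorphic (group_ballean K G) (group_ballean K H).

Section CardinalArithmetic.

(* A injects into B iff some relation, total on A, is injective on A:          *)
(* functionality is not required, as it can be arranged by choice.            *)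
Lemma card_le_relP T U (A : set T) (B : set U) :
  A #<= B <-> exists r : T -> U -> Prop,
    (forall a, A a -> exists2 b, B b & r a b) /\
    (forall a a' b, A a -> A a' -> r a b -> r a' b -> a = a').
Proof.
split=> [/card_leP[f]|[r [tot inj]]].
  exists (fun a b => exists2 x : A, val x = a & val (f x) = b); split.
    move=> a Aa; exists (val (f (SigSub (mem_set Aa)))); first exact: set_valP.
    by exists (SigSub (mem_set Aa)).
  move=> a a' b _ _ [x <- <-] [y <-] /val_inj E.
  by rewrite (@inj _ _ _ f y x) ?in_setT.
have ch (x : A) : {b : B | r (val x) (val b)}.
  apply: cid; have [b Bb rb] := tot _ (set_mem (valP x)).
  by exists (SigSub (mem_set Bb)).
pose f x := sval (ch x).
have finj : {in [set: A] &, injective f}.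
  move=> x y _ _ E; apply: val_inj; apply: (inj _ _ (val (f x))).
  - exact: set_mem (valP x).
  - exact: set_mem (valP y).
  - exact: svalP (ch x).
  - by rewrite E; exact: svalP (ch y).
rewrite -(card_le_eql (card_setT A)) -(card_le_eqr (card_setT B)).
by rewrite -(card_le_eql (inj_card_eq finj)); exact: card_leT.
Qed.

Lemma card_le_total T U (A : set T) (B : set U) : A #<= B \/ B #<= A.
Proof.
pose P (r : set (T * U)) := [/\ r `<=` A `*` B,
  forall a a' b, r (a, b) -> r (a', b) -> a = a' &
  forall a b b', r (a, b) -> r (a, b') -> b = b'].
have [F FP Ftot|r [[rAB rl rr] rmax]] := @Zorn_bigcup _ P.
  have common p q : (\bigcup_(X in F) X) p -> (\bigcup_(X in F) X) q ->
      exists2 X, P X & X p /\ X q.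
    move=> [X FX Xp] [Y FY Yq]; have [XY|YX] := Ftot _ _ FX FY.
      by exists Y; [exact: FP|split=> //; exact: XY].
    by exists X; [exact: FP|split=> //; exact: YX].
  split=> [p [X FX Xp]|a a' b Ha Hb|a b b' Ha Hb].
  - by have [XAB _ _] := FP _ FX; exact: XAB.
  - by have [X [_ Xl _] [Xa Xb]] := common _ _ Ha Hb; exact: Xl Xa Xb.
  - by have [X [_ _ Xr] [Xa Xb]] := common _ _ Ha Hb; exact: Xr Xa Xb.
have [hA|/existsNP[a /not_implyP[Aa ra]]] :=
    pselect (forall a, A a -> exists b, r (a, b)).
  left; apply/card_le_relP; exists (fun a b => r (a, b)); split.
    by move=> a /hA[b rab]; exists b => //; have [] := rAB _ rab.
  by move=> a a' b _ _; exact: rl.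
right; apply/card_le_relP; exists (fun b a => r (a, b)); split; last first.
  by move=> b b' a' _ _; exact: rr.
move=> b Bb; apply: contrapT => rb.
apply: (rmax (r `|` [set (a, b)])).
  by split=> [p rp|E]; [left|apply: ra; exists b; apply: E; right].
split.
- by move=> p [/rAB//|->].
- move=> x x' y [rx|E] [rx'|E'].
  + exact: rl rx rx'.
  + by case: E' rx => _ -> rx; case: rb; exists x => //; have [] := rAB _ rx.
  + by case: E rx' => _ -> rx; case: rb; exists x' => //; have [] := rAB _ rx.
  + by case: E => ->; case: E' => ->.
- move=> x y y' [rx|E] [rx'|E'].
  + exact: rr rx rx'.
  + by case: E' rx => -> _ rx; case: ra; exists y.
  + by case: E rx' => -> _ rx; case: ra; exists y'.
  + by case: E => _ ->; case: E' => _ ->.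
Qed.

Lemma card_ltNge T U (A : set T) (B : set U) : card_lt A B <-> ~ (B #<= A).
Proof. by split=> [[]//|BA]; split=> //; have [] := card_le_total A B. Qed.

Lemma card_le_setX T U V W (A : set T) (B : set U) (C : set V) (D : set W) :
  A #<= C -> B #<= D -> A `*` B #<= C `*` D.
Proof.
move=> /card_le_relP[r [rt ri]] /card_le_relP[s [st si]]; apply/card_le_relP.
exists (fun p q => r p.1 q.1 /\ s p.2 q.2); split.
  by move=> [a b] [/= /rt[c Cc rc] /st[d Dd sd]]; exists (c, d).
move=> [a b] [a' b'] [c d] [/= Aa Bb] [/= Aa' Bb'] [rc sd] [rc' sd'].
by rewrite (ri _ _ _ Aa Aa' rc rc') (si _ _ _ Bb Bb' sd sd').
Qed.

Lemma card_le_setU T U (A B : set T) (C : set U) : infinite_set C ->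
  A #<= C -> B #<= C -> A `|` B #<= C `*` C.
Proof.
move=> Cinf /card_le_relP[r [rt ri]] /card_le_relP[s [st si]].
have [c Cc] := infinite_setN0 Cinf.
have [c' [Cc' cc']] : exists c', C c' /\ c' <> c.
  apply: contrapT => H; apply: Cinf; apply: sub_finite_set (finite_set1 c).
  by move=> x Cx; apply: contrapT => xc; apply: H; exists x.
apply/card_le_relP.
exists (fun a p => (A a /\ r a p.1 /\ p.2 = c) \/ (B a /\ s a p.1 /\ p.2 = c')).
split=> [a [Aa|Ba]|a a' p _ _].
- by have [d Cd rd] := rt _ Aa; exists (d, c) => //; left.
- by have [d Cd rd] := st _ Ba; exists (d, c') => //; right.
- move=> [[Aa [ra E]]|[Ba [sa E]]] [[Aa' [ra' E']]|[Ba' [sa' E']]].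
  + exact: ri ra ra'.
  + by case: cc'; rewrite -E -E'.
  + by case: cc'; rewrite -E -E'.
  + exact: si sa sa'.
Qed.

(* Hessenberg: an infinite cardinal equals its square.                        *)
Lemma card_le_square T (A : set T) : infinite_set A -> A `*` A #<= A.
Proof.
move=> Ainf.
pose D (r : set (T * T * T)) := [set x | exists z, r ((x, x), z)].
pose good (r : set (T * T * T)) := [/\ D r `<=` A,
  forall x y, D r x -> D r y -> exists z, r ((x, y), z),
  forall x y z, r ((x, y), z) -> [/\ D r x, D r y & D r z] &
  forall p q z, r (p, z) -> r (q, z) -> p = q].
have mono (r s : set (T * T * T)) : r `<=` s -> D r `<=` D s.
  by move=> rs x [z /rs]; exists z.
have [r0 [g0 i0]] : exists r, good r /\ infinite_set (D r).
  move/infiniteP/card_le_relP : Ainf => [r [rt ri]].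
  have := card_nat2; rewrite card_eq_le => /andP[/card_le_relP[s [st si]] _].
  have /choice[f Hf] : forall n : nat, exists a, A a /\ r n a.
    by move=> n; have [a] := rt n I; exists a.
  have finj m n : f m = f n -> m = n.
    by move=> E; apply: (ri _ _ (f m)) => //; [apply (Hf m).2|rewrite E; apply (Hf n).2].
  pose r' := [set q : T * T * T | exists m n k,
    s (m, n) k /\ q = ((f m, f n), f k)].
  have Dr' n : D r' (f n).
    by have [k _ sk] := st (n, n) I; exists (f k); exists n, n, k.
  exists r'; split; last first.
    apply/infiniteP/card_le_relP; exists (fun n a => a = f n); split.
      by move=> n _; exists (f n).
    by move=> m n a _ _ -> /finj.
  split.
  - by move=> x [z [m [n [k [_ [-> _ _]]]]]]; exact: (Hf m).1.
  - move=> x y [z [m [n [k [_ [-> _ _]]]]]] [z' [m' [n' [k' [_ [-> _ _]]]]]].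
    by have [l _ sl] := st (m, m') I; exists (f l); exists m, m', l.
  - by move=> x y z [m [n [k [_ [-> -> ->]]]]].
  - move=> p q z [m [n [k [sk [-> ->]]]]] [m' [n' [k' [sk' [-> /finj E]]]]].
    by rewrite -E in sk'; have [-> ->] := si _ _ _ I I sk sk'.
have [F FP Ftot|r [gr rmax]] := @Zorn_bigcup _ (fun r => good (r `|` r0)).
  pose S := \bigcup_(X in F) X `|` r0.
  have sub X : F X -> X `|` r0 `<=` S.
    by move=> FX p [Xp|]; [left; exists X|right].
  have common p q : S p -> S q ->
      exists2 X, good X & [/\ X p, X q & X `<=` S].
    move=> [[X FX Xp]|r0p] [[Y FY Yq]|r0q].
    - have [XY|YX] := Ftot _ _ FX FY.
        exists (Y `|` r0); first exact: FP.
        by split; [left; exact: XY|left|exact: sub].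
      exists (X `|` r0); first exact: FP.
      by split; [left|left; exact: YX|exact: sub].
    - exists (X `|` r0); first exact: FP.
      by split; [left|right|exact: sub].
    - exists (Y `|` r0); first exact: FP.
      by split; [right|left|exact: sub].
    - by exists r0 => //; split=> // p'; right.
  split.
  - move=> x [z Sz]; have [X [+ _ _ _] [Xz _ _]] := common _ _ Sz Sz.
    by apply; exists z.
  - move=> x y [z Sz] [z' Sz']; have [X [_ + _ _] [Xz Xz' XS]] := common _ _ Sz Sz'.
    by case/(_ x y) => [||w /XS]; [exists z|exists z'|exists w].
  - move=> x y z Sz; have [X [_ _ + _] [Xz _ XS]] := common _ _ Sz Sz.
    by move=> /(_ _ _ _ Xz)[] /(mono _ _ XS)? /(mono _ _ XS)? /(mono _ _ XS)?.
  - by move=> p q z Sp Sq; have [X [_ _ _ Xi] [Xp Xq _]] := common _ _ Sp Sq; exact: Xi Xp Xq.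
move: gr; set s := r `|` r0 => gs.
have [DA tot ran inj] := gs; set X := D s in DA tot ran.
have Xinf : infinite_set X.
  by move=> Xf; apply: i0; apply: sub_finite_set Xf; apply: mono => p; right.
have XX : X `*` X #<= X.
  apply/card_le_relP; exists (fun p z => s (p, z)); split.
    by move=> [x y] [/= Xx Xy]; have [z sz] := tot _ _ Xx Xy; exists z => //; have [] := ran _ _ _ sz.
  by move=> p q z _ _; exact: inj.
have [AX|XA] := card_le_total (A `\` X) X.
  have {}AX : A #<= X.
    apply: card_le_trans XX; rewrite -(setDKU DA).
    by apply: card_le_setU => //; exact: card_lexx.
  apply: card_le_trans (card_le_setX AX AX) _.
  by apply: card_le_trans XX _; exact: subset_card_le.
have [Y [YA YX XY]] : exists Y, [/\ Y `<=` A `\` X, Y #<= X & X #<= Y].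
  move/card_le_relP : XA => [t [tt ti]].
  have /choice[f Hf] : forall x, exists y, X x -> (A `\` X) y /\ t x y.
    move=> x; have [/tt[y]|nX] := pselect (X x); first by exists y.
    by exists x.
  exists (f @` X); split; first by move=> _ [x /Hf[? _] <-].
    exact: card_image_le.
  apply/card_le_relP; exists (fun x y => X x /\ f x = y); split.
    by move=> x Xx; exists (f x) => //; exists x.
  move=> x x' y _ _ [Xx <-] [Xx' E]; apply: (ti _ _ (f x)) => //.
    exact: (Hf _ Xx).2.
  by rewrite -E; exact: (Hf _ Xx').2.
pose Z := X `|` Y.
have ZX : Z #<= X.
  by apply: card_le_trans XX; apply: card_le_setU => //; exact: card_lexx.
have : Z `*` Z #<= Y.
  by apply: card_le_trans (card_le_setX ZX ZX) _; apply: card_le_trans XX XY.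
move=> /card_le_relP[t [tt ti]].
pose s' := s `|` [set q | [/\ Z q.1.1, Z q.1.2, ~ (X q.1.1 /\ X q.1.2), Y q.2 & t q.1 q.2]].
have YnX y : Y y -> ~ X y by move=> /YA[].
have s'dom x y : Z x -> Z y -> exists z, s' ((x, y), z).
  move=> Zx Zy; have [[Xx Xy]|nX] := pselect (X x /\ X y).
    by have [z sz] := tot _ _ Xx Xy; exists z; left.
  by have [z Yz tz] := tt (x, y) (conj Zx Zy); exists z; right.
have Ds' : D s' = Z.
  apply/seteqP; split=> [x [z [sz|[]//]]|x Zx]; last exact: s'dom.
  by left; exists z.
have ss' : s' `|` r0 = s'.
  by apply/setUidPl => p r0p; left; right.
have [y Yy] : Y !=set0.
  have [x Xx] := infinite_setN0 Xinf; move/card_le_relP : XY => [u [/(_ _ Xx)[y Yy _] _]].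
  by exists y.
exfalso; apply: (rmax s').
  split; first by move=> p rp; left; left.
  move=> s'r; have [z s'z] := s'dom y y (or_intror Yy) (or_intror Yy).
  by apply: (YnX y Yy); exists z; left; exact: s'r.
rewrite ss'; split; rewrite ?Ds'.
- by move=> x [/DA|/YA[]].
- exact: s'dom.
- move=> x x' z [/ran[? ? ?]|[/= ? ? _ ? _]]; first by split; left.
  by split=> //; right.
- move=> [p1 p2] [q1 q2] z [sp|[/= ? ? _ Yz tp]] [sq|[/= ? ? _ Yz' tq]].
  + exact: inj sp sq.
  + by have [_ _ /(YnX _ Yz')] := ran _ _ _ sp.
  + by have [_ _ /(YnX _ Yz)] := ran _ _ _ sq.
  + exact: ti tp tq.
Qed.

Lemma infinite_card_lt T U (A : set T) (C : set U) :
  infinite_set C -> finite_set A -> card_lt A C.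
Proof.
by move=> Cinf Af; apply/card_ltNge => CA; apply: Cinf; exact: card_le_finite CA Af.
Qed.

Lemma card_lt_setX T U V (A : set T) (B : set U) (C : set V) :
  infinite_set C -> card_lt A C -> card_lt B C -> card_lt (A `*` B) C.
Proof.
move=> Cinf ltA ltB.
have [Af|Ainf] := pselect (finite_set A); last have [AB|BA] := card_le_total A B.
- have [Bf|Binf] := pselect (finite_set B).
    by apply: infinite_card_lt => //; exact: finite_setX.
  apply/card_ltNge => CAB; case: ltB => _ []; apply: card_le_trans CAB _.
  apply: card_le_trans (card_le_setX _ (card_lexx B)) (card_le_square Binf).
  by have [|BA] := card_le_total A B => //; case: Binf; exact: card_le_finite BA Af.
- have Binf : infinite_set B by move=> Bf; apply: Ainf; exact: card_le_finite AB Bf.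
  apply/card_ltNge => CAB; case: ltB => _ []; apply: card_le_trans CAB _.
  exact: card_le_trans (card_le_setX AB (card_lexx B)) (card_le_square Binf).
- apply/card_ltNge => CAB; case: ltA => _ []; apply: card_le_trans CAB _.
  exact: card_le_trans (card_le_setX (card_lexx A) BA) (card_le_square Ainf).
Qed.

Lemma card_lt_image T U V (f : T -> U) (A : set T) (C : set V) :
  card_lt A C -> card_lt (f @` A) C.
Proof.
move=> ltA; apply/card_ltNge => CA; case: ltA => _ [].
exact: card_le_trans CA (card_image_le _ _).
Qed.

Lemma card_lt_setU1 T U (A : set T) (x : T) (C : set U) :
  infinite_set C -> card_lt A C -> card_lt (A `|` [set x]) C.
Proof.
move=> Cinf ltA; have [Af|Ainf] := pselect (finite_set A).
  by apply: infinite_card_lt => //; rewrite finite_setU; split=> //; exact: finite_set1.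
have [a Aa] := infinite_setN0 Ainf.
have xA : [set x] #<= A.
  apply: (@card_le_trans _ _ _ [set a]); last by apply: subset_card_le => _ ->.
  by have := eq_card1 x a; rewrite card_eq_le => /andP[].
apply/card_ltNge => CA; case: ltA => _ []; apply: card_le_trans CA _.
apply: card_le_trans (card_le_square Ainf).
exact: card_le_setU Ainf (card_lexx A) xA.
Qed.

End CardinalArithmetic.

Lemma group_balleanP (K : Type) (G : groupType) :
  infinite_set [set: K] -> is_ballean (group_ballean K G).
Proof.
move=> Kinf.
have small (A : set G) : card_lt A [set: K] -> {a : small_subsets K G | sval a = A}.
  by move=> AK; exists (exist _ A AK).
have finsmall (A : set G) : finite_set A -> {a : small_subsets K G | sval a = A}.
  by move=> Af; apply: small; exact: infinite_card_lt.
have inv (a : small_subsets K G) :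
    {a' : small_subsets K G | sval a' = [set (x^-1)%g | x in sval a]}.
  by apply: small; apply: card_lt_image; exact: svalP a.
split.
- split=> [||g A].
  + by exists (1%g : G).
  + by have [a _] := finsmall set0 (finite_set0 _); exists a.
  + by exists 1%g; rewrite ?mul1g//; right.
- move=> a b; have [a' Ea] := inv a; have [b' Eb] := inv b.
  exists a', b' => x; split=> y.
    move=> [u au <-]; exists (u^-1)%g; last by rewrite mulgA mulVg mul1g.
    by case: au => [au|->]; [left; rewrite Ea; exists u|right; rewrite /= invg1].
  move=> [u bu <-]; exists (u^-1)%g; last by rewrite mulgA mulVg mul1g.
  by case: bu => [bu|->]; [left; rewrite Eb; exists u|right; rewrite /= invg1].
- move=> a b.
  have [|r Er] := small
      ((fun p => (p.1 * p.2)%g) @` ((sval b `|` [set 1%g]) `*` (sval a `|` [set 1%g]))).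
    apply: card_lt_image; apply: card_lt_setX => //; apply: card_lt_setU1 => //.
      exact: svalP b.
    exact: svalP a.
  exists r => x _ [_ [u au <-] [v bv <-]]; exists (v * u)%g; last by rewrite mulgA.
  by left; rewrite Er; exists (v, u).
- move=> x y; have [a Ea] := finsmall [set (y * x^-1)%g] (finite_set1 _).
  by exists a; exists (y * x^-1)%g; [left; rewrite Ea|rewrite -mulgA mulVg mulg1].
Qed.

(* Main.v *)
From HB Require Import structures.
Require Import Defs.
From mathcomp Require Import all_boot all_algebra.
From mathcomp Require Import all_classical.
From mathcomp Require Import wochoice.

Set Implicit Arguments.
Unset Strict Implicit.
Unset Printing Implicit Defensive.

Import GRing.Theory.

Local Open Scope ring_scope.
Local Open Scope classical_set_scope.
Local Open Scope card_scope.

(** Why the theorem holds.  Call a bijection between two groups compatible with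
    subgroups [A] and [B] if it carries the cosets of [A] onto those of [B].
    It suffices to find one bijection [f] from [G] to the free Abelian group
    such that every small subset of either group lies in a
    member of a compatible pair of small subgroups
    ([prec_mapping_of_differences]).

    Coordinates.  Well-order [G] and keep the elements outside the subgroup
    generated by their predecessors.  The kept elements [e j] generate [G], which
    is uncountable, so there are [gamma] of them, and they may be indexed by
    [Gamma * nat].  For each [j], the integers [k] with [k e_j] in the subgroup
    generated by the earlier generators form an ideal [N_j]; fix representatives
    of the cosets of [N_j], with 0 among them.  Subtracting from the top down
    shows that each element of [G] is the value of exactly one finite
    combination of the [e j] whose coefficients are representatives
    ([exists_normal], [normal_unique]).

    Compatibility.  Call a set [S] of indices closed if, for [j] in [S] and [k]
    in [N_j], the element [k e_j] is a combination of earlier generators whose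
    indices are in [S].  Modulo the subgroup generated by a closed [S], the
    normal coordinates outside [S] are invariants, and conversely they determine
    the coset ([normal_coset]).  Closedness imposes countably many finitary
    conditions at each index, so a small set of indices has a small closure
    because [K] is uncountable ([card_lt_closure]).

    Regrouping.  A single coordinate takes values in a set of representatives
    that may be finite, and is at least a pair because 1 is not in [N_j].  The
    countably many coordinates [(i, n)] with a given [i], taken together, take
    values in a countably infinite set, which is put in bijection with the
    integers, 0 going to 0 ([exists_regrouping]).  The regrouped coordinates are
    arbitrary finitely supported integer functions on [Gamma], that is, elements
    of the free Abelian group, and a set of indices of the form [S * nat]
    corresponds to the subgroup of combinations supported on [S]. *)

(** * Cardinalities *)

Lemma card_le_lt_trans T U V (A : set T) (B : set U) (C : set V) :
  A #<= B -> card_lt B C -> card_lt A C.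
Proof.
move=> AB [_ CB]; apply/card_ltNge => CA.
exact/CB/(card_le_trans CA).
Qed.

Lemma inj_card_leT T U (f : T -> U) : injective f -> [set: T] #<= [set: U].
Proof.
move=> fI; apply/card_le_relP; exists (fun a b => f a = b); split.
  by move=> a _; exists (f a).
by move=> a a' b _ _ <- /fI.
Qed.

Lemma card_leT_inj T U :
  [set: T] #<= [set: U] -> exists f : T -> U, injective f.
Proof.
move=> /card_le_relP[r [rt ri]].
have /choice[f Hf] : forall a, exists b, r a b.
  by move=> a; have [b _ rab] := rt a I; exists b.
exists f => a a' E; apply: (ri _ _ (f a)) => //; rewrite E; exact: Hf.
Qed.

Lemma card_eq_parametrization I T (J : set T) :
  [set: I] #= J ->
  exists h : I -> T,
    [/\ injective h, forall i, J (h i) & forall x, J x -> exists i, h i = x].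
Proof.
move=> /card_bijP[f [f' fK f'K]].
exists (fun i => val (f (SigSub (mem_setT i)))); split.
- by move=> i j /val_inj/(can_inj fK)[].
- by move=> i; exact: set_valP.
- move=> x /mem_set Jx; exists (val (f' (SigSub Jx))).
  rewrite [X in f X](_ : _ = f' (SigSub Jx)) ?f'K //; exact: val_inj.
Qed.

(** Iterating a pairing function codes the lists of each given length; the
    length itself is recorded as a further component. *)
Lemma card_le_seq T : infinite_set [set: T] -> [set: seq T] #<= [set: T].
Proof.
move=> Tinf.
have [p pI] : exists p : T * T -> T, injective p.
  by apply: card_leT_inj; rewrite -setXTT; exact: card_le_square.
have [c cI] : exists c : nat -> T, injective c.
  by apply: card_leT_inj; exact/infiniteP.
pose code (s : seq T) := foldr (fun x a => p (x, a)) (c 0) s.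
have codeI s t : size s = size t -> code s = code t -> s = t.
  elim: s t => [|x s IH] [|y t] //= [st] /pI[-> E].
  by rewrite (IH _ st E).
apply: (@inj_card_leT _ _ (fun s => p (c (size s), code s))) => s t.
by move=> /pI[/cI]; exact: codeI.
Qed.

Lemma card_lt_infinite V (C : set V) :
  card_lt [set: nat] C -> infinite_set C.
Proof.
move=> [natC _]; exact/infiniteP.
Qed.

Lemma countable_card_lt (T : countType) V (A : set T) (C : set V) :
  card_lt [set: nat] C -> card_lt A C.
Proof.
move=> ltC; apply: card_le_lt_trans ltC.
exact: card_le_trans (card_leT A) (inj_card_leT (pcan_inj pickleK)).
Qed.

(** The closure of [A] consists of the values of finite sequences of
    operations, out of a countable stock, applied to elements of [A]. *)
Lemma card_lt_closure (T : eqType) (Q : countType) V (u : T -> Q -> seq T)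
    (A : set T) (C : set V) :
  card_lt [set: nat] C -> card_lt A C ->
  exists S : set T, [/\ A `<=` S, card_lt S C
    & forall x q y, S x -> y \in u x q -> S y].
Proof.
move=> ltC ltA.
pose op x (q : Q * nat) := nth x (u x q.1) q.2.
exists ((fun p => foldl op p.1 p.2) @` (A `*` [set: seq (Q * nat)])); split.
- by move=> x Ax; exists (x, [::]).
- apply: card_lt_image; apply: card_lt_setX ltA _.
    exact: card_lt_infinite.
  exact: countable_card_lt.
- move=> x q y [[a s] [/= Aa _] ax] yu.
  exists (a, rcons s (q, index y (u x q))) => //=.
  by rewrite foldl_rcons ax /op nth_index.
Qed.

(** * Finitely supported integer combinations *)

Definition supported (I : choiceType) (S : set I) (c : {freeg I}) :=
  forall i, coeff i c != 0 -> S i.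

Definition combination (I : choiceType) (G : zmodType) (e : I -> G)
    (c : {freeg I}) : G :=
  fglift (e : I -> zmodule G) c.

Definition span (I : choiceType) (G : zmodType) (e : I -> G) (S : set I) :
    set G :=
  combination e @` [set c | supported S c].

Lemma combination_is_additive (I : choiceType) (G : zmodType) (e : I -> G) :
  zmod_morphism (combination e).
Proof. exact: (lift_is_additive (M := zmodule G) e). Qed.

HB.instance Definition _ (I : choiceType) (G : zmodType) (e : I -> G) :=
  GRing.isZmodMorphism.Build {freeg I} G (combination e)
    (combination_is_additive e).

Lemma combinationU (I : choiceType) (G : zmodType) (e : I -> G) k i :
  combination e << k *g i >> = e i *~ k.
Proof. exact: (liftU (M := zmodule G)). Qed.

Lemma combinationE (I : choiceType) (G : zmodType) (e : I -> G) c :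
  combination e c = \sum_(i <- dom c) e i *~ coeff i c.
Proof.
rewrite -[in LHS](freeg_sumE c) raddf_sum.
by apply: eq_bigr => i _; rewrite /= combinationU.
Qed.

Lemma freegP (I : choiceType) (c d : {freeg I}) :
  (forall i, coeff i c = coeff i d) -> c = d.
Proof. by move=> E; apply/eqP/freeg_eqP. Qed.

Lemma coeff_outside (I : choiceType) (S : set I) (c : {freeg I}) i :
  supported S c -> ~ S i -> coeff i c = 0.
Proof. by move=> Sc nSi; apply/eqP; apply: contrapT => /negP/Sc. Qed.

Lemma supportedW (I : choiceType) (S T : set I) (c : {freeg I}) :
  S `<=` T -> supported S c -> supported T c.
Proof. by move=> ST Sc i /Sc/ST. Qed.

Lemma supported0 (I : choiceType) (S : set I) : supported S (0 : {freeg I}).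
Proof. by move=> i; rewrite coeff0 eqxx. Qed.

Lemma supportedD (I : choiceType) (S : set I) (c d : {freeg I}) :
  supported S c -> supported S d -> supported S (c + d).
Proof.
move=> Sc Sd i; rewrite coeffD.
have [->|/Sc//] := eqVneq (coeff i c) 0; rewrite add0r; exact: Sd.
Qed.

Lemma supportedN (I : choiceType) (S : set I) (c : {freeg I}) :
  supported S c -> supported S (- c).
Proof. by move=> Sc i; rewrite coeffN oppr_eq0 => /Sc. Qed.

Lemma supportedB (I : choiceType) (S : set I) (c d : {freeg I}) :
  supported S c -> supported S d -> supported S (c - d).
Proof. by move=> Sc Sd; apply: supportedD => //; exact: supportedN. Qed.

Lemma supportedU (I : choiceType) (S : set I) (k : int) i :
  S i -> supported S << k *g i >>.
Proof.
move=> Si j; rewrite coeffU.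
by case: (eqVneq i j) => [<-|]; rewrite ?mulr0 ?eqxx.
Qed.

Lemma spanB (I : choiceType) (G : zmodType) (e : I -> G) S x y :
  span e S x -> span e S y -> span e S (x - y).
Proof.
move=> [c Sc <-] [d Sd <-]; exists (c - d); last exact: raddfB.
exact: supportedB.
Qed.

Lemma span0 (I : choiceType) (G : zmodType) (e : I -> G) S : span e S 0.
Proof. by exists 0; [exact: supported0|exact: raddf0]. Qed.

Lemma spanD (I : choiceType) (G : zmodType) (e : I -> G) S x y :
  span e S x -> span e S y -> span e S (x + y).
Proof.
move=> Sx Sy; rewrite -[y]opprK -[- y]add0r.
by do 2![apply: spanB => //]; exact: span0.
Qed.

Lemma spanMz (I : choiceType) (G : zmodType) (e : I -> G) S x (k : int) :
  span e S x -> span e S (x *~ k).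
Proof.
move=> [c Sc <-]; exists (c *~ k); last exact: raddfMz.
by move=> i; rewrite raddfMz mulrz_eq0 negb_or => /andP[_ /Sc].
Qed.

Lemma span_generator (I : choiceType) (G : zmodType) (e : I -> G) S i :
  S i -> span e S (e i).
Proof.
move=> Si; exists << i >>; first exact: supportedU.
by rewrite combinationU mulr1z.
Qed.

Lemma span_min (I J : choiceType) (G : zmodType) (e : I -> G) (e' : J -> G)
    S T :
  (forall i, S i -> span e' T (e i)) -> span e S `<=` span e' T.
Proof.
move=> ST _ [c Sc <-]; rewrite combinationE big_seq.
elim/big_ind: _ => [|x y|i]; [exact: span0|exact: spanD|].
by rewrite mem_dom => /Sc/ST; exact: spanMz.
Qed.

(** Combinations supported on [S] are coded by lists of terms.  The index of a
    term is optional only to make the type of terms infinite even when [S] is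
    empty. *)
Lemma card_lt_supported (I : choiceType) V (S : set I) (C : set V) :
  card_lt [set: nat] C -> card_lt S C ->
  card_lt [set c : {freeg I} | supported S c] C.
Proof.
move=> ltC ltS; have Cinf := card_lt_infinite ltC.

have ltS' : card_lt [set: option S] C.
  have -> : [set: option S] = Some @` [set: S] `|` [set None].
    by apply/seteqP; split=> // -[x|] _; [left; exists x|right].
  apply: card_lt_setU1 => //; apply: card_lt_image.
  apply: card_le_lt_trans ltS.
  by have := card_setT S; rewrite card_eq_le => /andP[].
have ltW : card_lt [set: option S * int] C.
  rewrite -setXTT; apply: card_lt_setX => //; exact: countable_card_lt.
have Winf : infinite_set [set: option S * int].
  apply/infiniteP/(@inj_card_leT _ _ (fun n : nat => (None, n%:Z))).
  by move=> m n [].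
pose decode (s : seq (option S * int)) : {freeg I} :=
  \sum_(p <- s) if p.1 is Some i then << p.2 *g val i >> else 0.
apply: (@card_le_lt_trans _ _ _ _ (decode @` setT)).
  apply: subset_card_le => c Sc.
  exists [seq (insub i, coeff i c) | i <- dom c] => //.
  rewrite -[RHS]freeg_sumE /decode big_map; apply: eq_big_seq => i /=.
  by rewrite mem_dom => /Sc Si; rewrite insubT ?inE.
exact: card_lt_image (card_le_lt_trans (card_le_seq Winf) ltW).
Qed.

(** The list [s] only witnesses that the support of [h] is finite; it may repeat
    indices. *)
Lemma exists_freeg (I : choiceType) (s : seq I) (h : I -> int) :
  (forall i, h i != 0 -> i \in s) ->
  exists c : {freeg I}, forall i, coeff i c = h i.
Proof.
move=> hs; exists (\sum_(i <- undup s) << h i *g i >>) => i.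
rewrite raddf_sum /=; under eq_bigr do rewrite coeffU.
have [is_|/negP ins] := boolP (i \in undup s).
  rewrite (bigD1_seq i) ?undup_uniq //= eqxx mulr1 big1 ?addr0 // => j /negPf ->.
  by rewrite mulr0.
rewrite big_seq big1 => [|j js].
  by apply/esym/eqP; apply: contrapT => /negP/hs; rewrite -mem_undup.
by case: eqVneq js ins => [->//|]; rewrite mulr0.
Qed.

(** * Well-ordered generators and normal forms *)

Record strict_well_order (I : Type) (lt : I -> I -> Prop) : Prop := {
  swo_wf : well_founded lt;
  swo_trans : forall i j k, lt i j -> lt j k -> lt i k;
  swo_total : forall i j, [\/ i = j, lt i j | lt j i] }.

Lemma exists_strict_well_order (T : eqType) :
  exists lt : T -> T -> Prop, strict_well_order lt.
Proof.
have [R Rwo] := well_ordering_principle T.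
have minP (A : {pred T}) x : x \in A ->
    exists2 z, z \in A & {in A, forall y, R z y}.
  by move=> Ax; have [|z [[Az zA] _]] := Rwo A; [exists x|exists z].
have RT x y : R x y || R y x.
  have [|z] := minP (pred2 x y) x; first by rewrite inE eqxx.
  by rewrite inE => /pred2P[] -> ->; rewrite ?orbT // inE eqxx ?orbT.
have Ranti x y : R x y -> R y x -> x = y.
  move=> Rxy Ryx; have [|z [_ zU]] := Rwo (pred2 x y).
    by exists x; rewrite inE eqxx.
  have Rxx u : R u u by have := RT u u; rewrite orbb.
  rewrite -(zU x) ?(zU y) //; split; rewrite ?inE ?eqxx ?orbT // => u;
    by rewrite inE => /pred2P[] ->.
exists (fun x y => ~~ R y x); split.
- move=> x; apply: contrapT => nAx.
  have [|z] := minP [pred y | `[< ~ Acc (fun x y => ~~ R y x) y >]] x.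
    exact/asboolP.
  move=> /asboolP nAz zmin; apply: nAz; split=> y /negP nR.
  by apply: contrapT => nAy; apply/nR/zmin/asboolP.
- move=> x y z nyx nzy; apply/negP => Rzx.
  have [|m] := minP (pred3 x y z) x; first by rewrite inE /= eqxx.
  rewrite inE /= => /or3P[]/eqP-> min.
  + have Rxz : R x z by apply: min; rewrite inE /= eqxx !orbT.
    move: nzy (RT x y); rewrite (Ranti _ _ Rzx Rxz) (negPf nyx) orbF.
    by move=> /negPf->.
  + by move/negP: nyx; apply; apply: min; rewrite inE /= eqxx.
  + by move/negP: nzy; apply; apply: min; rewrite inE /= eqxx orbT.
- move=> x y; case: (eqVneq x y) => [->|/eqP xy]; first by constructor 1.
  have [Rxy|] := boolP (R x y); last by constructor 3.
  by constructor 2; apply/negP => /(Ranti _ _ Rxy).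
Qed.

Lemma swo_irr (I : Type) (lt : I -> I -> Prop) i :
  strict_well_order lt -> ~ lt i i.
Proof.
by move=> wo; elim/(well_founded_ind (swo_wf wo)): i => i IH /[dup] /IH.
Qed.

Lemma exists_max (I : choiceType) (lt : I -> I -> Prop) (s : seq I) :
  strict_well_order lt -> s != [::] ->
  exists2 j, j \in s & forall i, i \in s -> i = j \/ lt i j.
Proof.
move=> wo; elim: s => [//|a [|b s] IH] _.
  by exists a => [|i]; rewrite inE // => /eqP; left.
have [//|j js jmax] := IH.
have [aj|aj|ja] := swo_total wo a j.
- by exists j => [|i]; rewrite in_cons ?js ?orbT // => /orP[/eqP->|/jmax//]; left.
- by exists j => [|i]; rewrite in_cons ?js ?orbT // => /orP[/eqP->|/jmax//]; right.
- exists a => [|i]; rewrite in_cons ?eqxx //.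
  move=> /orP[/eqP|/jmax[->|ij]]; [by left|by right|right].
  exact: (swo_trans wo ij ja).
Qed.

Definition below (I : Type) (lt : I -> I -> Prop) (j : I) : set I :=
  [set i | lt i j].

(** Well-founded induction on the largest index of the support. *)
Lemma leading_index_ind (I : choiceType) (lt : I -> I -> Prop)
    (P : {freeg I} -> Prop) :
  strict_well_order lt -> P 0 ->
  (forall c j, coeff j c != 0 -> supported [set i | i = j \/ lt i j] c ->
    (forall d, supported (below lt j) d -> P d) -> P c) ->
  forall c, P c.
Proof.
move=> wo P0 Pstep.
have Plead j : forall c, coeff j c != 0 ->
    supported [set i | i = j \/ lt i j] c -> P c.
  elim/(well_founded_ind (swo_wf wo)): j => j IH c cj cle.
  apply: (Pstep c j) => // d dj.
  have [->//|d0] := eqVneq d 0.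
  have [|m] := exists_max (s := dom d) wo; first by rewrite dom_eq0.
  rewrite mem_dom => dm mmax; apply: (IH m) => //; first exact: dj.
  by move=> i; rewrite -mem_dom; exact: mmax.
move=> c; have [->//|c0] := eqVneq c 0.
have [|m] := exists_max (s := dom c) wo; first by rewrite dom_eq0.
rewrite mem_dom => cm mmax; apply: (Plead m) => // i.
by rewrite -mem_dom; exact: mmax.
Qed.

Lemma supported_tail (I : choiceType) (lt : I -> I -> Prop) (c : {freeg I}) j :
  supported [set i | i = j \/ lt i j] c ->
  supported (below lt j) (c - << coeff j c *g j >>).
Proof.
move=> cle i; rewrite coeffB coeffU; case: (eqVneq j i) => [<-|ji].
  by rewrite mulr1 subrr eqxx.
rewrite mulr0 subr0 => /cle[ij|//].
by rewrite ij eqxx in ji.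
Qed.

(** That 0 represents its own coset makes a coefficient that is already zero
    count as reduced. *)
Lemma exists_transversal (A : zmodType) (N : set A) :
  N 0 -> (forall x y, N x -> N y -> N (x - y)) ->
  exists r : A -> A, [/\ r 0 = 0, forall x, N (x - r x)
    & forall x y, N (x - y) -> r x = r y].
Proof.
move=> N0 NB.
have NN x : N x -> N (- x) by rewrite -sub0r; exact: NB.
have ND x y : N x -> N y -> N (x + y).
  by move=> Nx Ny; rewrite -[y]opprK; apply/NB/NN.
exists (fun x => if `[< N x >] then 0 else xget 0 [set y | N (x - y)]).
split=> [|x|x y Nxy].
- by rewrite asboolT.
- case: asboolP => [|_]; first by rewrite subr0.
  by case: xgetP => [? _ //|/(_ x)]; rewrite /= subrr.
- have -> : [set z | N (x - z)] = [set z | N (y - z)].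
    apply/seteqP; split=> z /= Nz.
      have -> : y - z = x - z - (x - y).
        by rewrite opprB [RHS]addrC addrA subrK.
      exact: NB.
    by rewrite /= -[x](subrK y) -addrA; exact: ND.
  have -> // : `[< N x >] = `[< N y >].
  apply: asbool_equiv_eq; split=> [Nx|Ny].
    by rewrite -[y](subKr x); exact: NB.
  by rewrite -[x](subrK y); exact: ND.
Qed.

Section NormalForms.
Variables (I : choiceType) (lt : I -> I -> Prop) (G : zmodType) (e : I -> G).
Hypothesis wo : strict_well_order lt.

(** The annihilator of [e j] modulo the subgroup generated by the earlier
    generators. *)
Definition order_ideal (j : I) : set int :=
  [set k | span e (below lt j) (e j *~ k)].

Lemma exists_remainder : exists rem : I -> int -> int,
  [/\ forall j, rem j 0 = 0, forall j k, order_ideal j (k - rem j k)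
    & forall j k l, order_ideal j (k - l) -> rem j k = rem j l].
Proof.
have /choice[rem Hrem] : forall j, exists r : int -> int,
    [/\ r 0 = 0, forall k, order_ideal j (k - r k)
      & forall k l, order_ideal j (k - l) -> r k = r l].
  move=> j; apply: exists_transversal.
    by rewrite /order_ideal /= mulr0z; exact: span0.
  by move=> k l Nk Nl; rewrite /order_ideal /= mulrzBr; exact: spanB.
by exists rem; split=> j; have [] := Hrem j.
Qed.

Variable rem : I -> int -> int.
Hypothesis rem0 : forall j, rem j 0 = 0.
Hypothesis rem_equiv : forall j k, order_ideal j (k - rem j k).
Hypothesis rem_eq : forall j k l, order_ideal j (k - l) -> rem j k = rem j l.

Definition normal (c : {freeg I}) := forall j, rem j (coeff j c) = coeff j c.

(** The leading coefficient is reduced to its representative; the difference is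
    a combination of earlier generators, which joins the tail, and the induction
    applies to the new tail.  The bound on the support makes the normal form of
    the tail free of the leading index. *)
Lemma exists_normal c : exists d,
  [/\ normal d, combination e d = combination e c
  & forall a, supported (below lt a) c -> supported (below lt a) d].
Proof.
move: c; apply: (leading_index_ind wo) => [|c j cj cle IH].
  by exists 0; split=> // j; rewrite coeff0 rem0.
set k := coeff j c.
have [q qj Eq] := rem_equiv j k.
have [|d [dn dE dlt]] := IH (c - << k *g j >> + q).
  by apply: supportedD => //; exact: supported_tail.
have dj : supported (below lt j) d.
  by apply: dlt; apply: supportedD => //; exact: supported_tail.
have d0 : coeff j d = 0.
  by apply: (coeff_outside dj) => /(swo_irr wo).
exists (d + << rem j k *g j >>); split.
- move=> i; rewrite coeffD coeffU; case: (eqVneq j i) => [<-|ji].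
    rewrite d0 add0r mulr1; apply/esym/rem_eq; exact: rem_equiv.
  by rewrite mulr0 addr0; exact: dn.
- rewrite raddfD /= dE !raddfD raddfN /= !combinationU Eq mulrzBr.
  by rewrite addrA -addrA -addrA subrK subrK.
- move=> a ca; have ja := ca _ cj; apply: supportedD; last exact: supportedU.
  by apply: supportedW dj => i ij; exact: (swo_trans wo ij ja).
Qed.

(** In a relation, the leading coefficient lies in the order ideal of the
    leading index [j].  If [j] is outside [S], it is therefore zero, which is
    absurd.  If [j] is in [S], closedness of [S] replaces the leading term by
    earlier ones with indices in [S], so that the coefficients outside [S] do
    not change and the leading index drops. *)
Lemma relation_supported (S : set I) :
  (forall j k, S j -> order_ideal j k ->
    span e (S `&` below lt j) (e j *~ k)) ->
  forall w, combination e w = 0 ->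
  (forall i, ~ S i -> order_ideal i (coeff i w) -> coeff i w = 0) ->
  supported S w.
Proof.
move=> Sclosed.
apply: (leading_index_ind wo) => [|w j wj wle IH] w0 wS; first exact: supported0.
set w' := w - << coeff j w *g j >>.
have w'j : supported (below lt j) w' by exact: supported_tail.
have ww' : e j *~ coeff j w = combination e (- w').
  by rewrite raddfN raddfB /= w0 combinationU sub0r opprK.
have Nj : order_ideal j (coeff j w).
  by rewrite /order_ideal /= ww'; exists (- w') => //; exact: supportedN.
have Sj : S j.
  by apply: contrapT => nSj; move: wj; rewrite (wS j) ?eqxx.
have [q Sq Eq] := Sclosed _ _ Sj Nj.
have q' i : ~ S i -> coeff i (w' + q) = coeff i w.
  move=> nSi; rewrite !coeffD coeffN coeffU.
  have -> : coeff i q = 0 by apply: (coeff_outside Sq) => -[].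
  case: eqVneq => [ji|_]; first by rewrite -ji in nSi.
  by rewrite mulr0 subr0 addr0.
have Sw'q : supported S (w' + q).
  apply: IH.
  - by apply: supportedD => //; apply: supportedW Sq => i [].
  - by rewrite raddfD /= Eq ww' raddfN subrr.
  - by move=> i nSi; rewrite q' //; exact: wS.
move=> i wi; apply: contrapT => nSi.
by apply/nSi/Sw'q; rewrite q'.
Qed.

(** Subtracting from [c - d] a combination that puts its value in the span of
    [S] gives a relation whose coefficients outside [S] are differences of two
    representatives, as [relation_supported] requires. *)
Lemma normal_coset (S : set I) c d :
  (forall j k, S j -> order_ideal j k ->
    span e (S `&` below lt j) (e j *~ k)) ->
  normal c -> normal d -> span e S (combination e c - combination e d) ->
  forall i, ~ S i -> coeff i c = coeff i d.
Proof.
move=> Sclosed cn dn [s Ss Es] i nSi.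
have cdE j : ~ S j -> coeff j (c - d - s) = coeff j c - coeff j d.
  move=> nSj; rewrite !coeffB.
  by rewrite (coeff_outside Ss nSj) subr0.
have : supported S (c - d - s).
  apply: relation_supported => // [|j nSj].
    by rewrite !raddfB /= Es subrr.
  by rewrite cdE // => /rem_eq; rewrite cn dn => ->; rewrite subrr.
move=> /coeff_outside/(_ nSi); rewrite cdE // => /eqP.
by rewrite subr_eq0 => /eqP.
Qed.

Lemma normal_unique c d :
  normal c -> normal d -> combination e c = combination e d -> c = d.
Proof.
move=> cn dn E; apply: freegP => i.
apply: (@normal_coset set0) => //; rewrite E subrr; exact: span0.
Qed.

End NormalForms.

(** The generators outside the span of their predecessors for some well-order;
    by well-founded induction, they span the others. *)
Lemma exists_independent_set (G : zmodType) :
  exists (lt : G -> G -> Prop) (J : set G),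
    [/\ strict_well_order lt,
        forall g, J g -> ~ span id (below lt g) g
      & forall x, span id J x].
Proof.
have [lt wo] := exists_strict_well_order G.
exists lt, [set g | ~ span id (below lt g) g]; split=> // x.
elim/(well_founded_ind (swo_wf wo)): x => x IH.
have [xx|] := pselect (span id (below lt x) x); last first.
  by move=> Jx; exact: (@span_generator _ _ id _ x Jx).
by apply: span_min xx => y; exact: IH.
Qed.

Lemma card_le_generators (I : choiceType) (G : zmodType) (e : I -> G)
    (S : set I) :
  card_lt [set: nat] [set: G] -> (forall x, span e S x) -> [set: G] #<= S.
Proof.
move=> ltG eS; apply: contrapT => /card_ltNge ltS.
have := card_lt_image (combination e) (card_lt_supported ltG ltS).
move=> [_ []]; apply: subset_card_le => x _; exact: eS.
Qed.

Lemma card_prod_nat (T : Type) :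
  infinite_set [set: T] -> [set: T * nat] #= [set: T].
Proof.
move=> Tinf; have [c cI] : exists c : nat -> T, injective c.
  by apply: card_leT_inj; exact/infiniteP.
rewrite card_eq_le; apply/andP; split; last first.
  by apply: (@inj_card_leT _ _ (fun x => (x, 0%N))) => x y [].
apply: card_le_trans (card_le_square Tinf); rewrite setXTT.
by apply: (@inj_card_leT _ _ (fun p => (p.1, c p.2))) => -[x m] [y n] [-> /cI->].
Qed.

(** The independent set generates an uncountable group, so that it has the
    cardinality of the group and can be indexed by any type of that
    cardinality; the well-order is pulled back along the indexing. *)
Lemma exists_independent_family (I : choiceType) (G : zmodType) :
  card_lt [set: nat] [set: G] -> [set: I] #= [set: G] ->
  exists (lt : I -> I -> Prop) (e : I -> G),
    [/\ strict_well_order lt, forall i, ~ span e (below lt i) (e i)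
      & forall x, span e setT x].
Proof.
move=> ltG; rewrite card_eq_le => /andP[IG GI].
have [ltJ [J [wo Jind Jgen]]] := exists_independent_set G.
have : [set: I] #= J.
  rewrite card_eq_le; apply/andP; split; last exact: card_le_trans (card_leT J) GI.
  exact: card_le_trans IG (card_le_generators ltG Jgen).
move=> /card_eq_parametrization[e [eI eJ eS]].
exists (fun i j => ltJ (e i) (e j)), e; split.
- split.
  + suff acc g : forall i, e i = g -> Acc (fun i j => ltJ (e i) (e j)) i.
      by move=> i; exact: acc.
    elim/(well_founded_ind (swo_wf wo)): g => g IH i ig.
    by split=> j lt_ji; rewrite -ig in IH; exact: (IH (e j) lt_ji).
  + by move=> i j k ij; exact: (swo_trans wo ij).
  + move=> i j; have [/eI|ij|ji] := swo_total wo (e i) (e j);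
      by [constructor 1|constructor 2|constructor 3].
- move=> i ei; apply: (Jind (e i)) => //.
  by apply: span_min ei => j ji; exact: span_generator.
- move=> x; apply: span_min (Jgen x) => g /eS[i <-].
  exact: span_generator.
Qed.

(** * Regrouping coordinates into countable blocks *)

Lemma countable_freeg_nat : countable [set: {freeg nat}].
Proof.
pose Q : set (seq (int * nat)) := setT.
have : [set: {freeg nat}] #<= (fun s : seq (int * nat) => [freeg s]) @` Q.
  apply: subset_card_le => c _; exists [seq (coeff i c, i) | i <- dom c] => //.
  exact: Freeg_dom.
move=> /card_le_trans; apply; apply: card_le_trans (card_image_le _ _) _.
exact: inj_card_leT (pcan_inj pickleK).
Qed.

(** A translation moves the image of [a] to 0. *)
Lemma exists_pointed_bijection (T : Type) (A : set T) (a : T) :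
  countable A -> infinite_set A -> A a ->
  exists b : T -> int, [/\ b a = 0, {in A &, injective b}
    & forall k, exists2 x, A x & b x = k].
Proof.
move=> Acount Ainf Aa.
have : [set: int] #= A.
  rewrite card_eq_le; apply/andP; split; last first.
    by apply: card_le_trans Acount (inj_card_leT (f := Posz) _) => m n [].
  apply: card_le_trans (inj_card_leT (pcan_inj (@pickleK int))) _.
  exact/infiniteP.
move=> /card_eq_parametrization[h [hI hA hS]].
have /choice[b Hb] : forall x, exists k, A x -> h k = x.
  by move=> x; have [/hS[k hk]|] := pselect (A x); [exists k|exists 0].
exists (fun x => b x - b a); split; first by rewrite subrr.
  move=> x y /set_mem Ax /set_mem Ay /addIr E.
  by rewrite -(Hb x Ax) E Hb.
move=> k; exists (h (k + b a)) => //.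
by rewrite (hI _ _ (Hb _ (hA (k + b a)))) addrK.
Qed.

(** The block of [c] at [i] is the function [n |-> coeff (i, n) c].  The blocks
    that can occur at [i] form an infinite set because each [A (i, n)] contains
    a nonzero integer.  That 0 corresponds to the zero block keeps supports
    finite in both directions. *)
Lemma exists_regrouping (I : choiceType) (A : I * nat -> set int) :
  (forall j, A j 0) -> (forall j, exists2 k, A j k & k != 0) ->
  exists F : {freeg (I * nat)%type} -> {freeg I},
    (forall c d, (forall j, A j (coeff j c)) -> (forall j, A j (coeff j d)) ->
      forall i, coeff i (F c) = coeff i (F d) <->
        forall n, coeff (i, n) c = coeff (i, n) d) /\
    (forall d, exists2 c, forall j, A j (coeff j c) & F c = d).
Proof.
move=> A0 A1.
pose E i : set {freeg nat} := [set h | forall n, A (i, n) (coeff n h)].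
have E0 i : E i 0 by move=> n; rewrite coeff0.
have /choice[b Hb] : forall i, exists b : {freeg nat} -> int,
    [/\ b 0 = 0, {in E i &, injective b}
      & forall k, exists2 x, E i x & b x = k].
  move=> i; apply: exists_pointed_bijection => //.
    exact: card_le_trans (card_leT _) countable_freeg_nat.
  have /choice[k Hk] : forall n, exists k, A (i, n) k /\ k != 0.
    by move=> n; have [k] := A1 (i, n); exists k.
  (* Blocks with a single nonzero coordinate are already infinitely many. *)
  apply/infiniteP/card_le_relP; exists (fun n h => h = << k n *g n >>); split.
    move=> n _; exists << k n *g n >> => // m; rewrite coeffU.
    by case: eqVneq => [<-|_]; rewrite ?mulr1 ?mulr0 //; exact: (Hk n).1.
  move=> m n _ _ _ -> /(congr1 (coeff m)); rewrite !coeffU eqxx mulr1.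
  by case: eqVneq => // _; rewrite mulr0 => km; have [_] := Hk m; rewrite km eqxx.
have /choice[B HB] : forall p : I * {freeg (I * nat)%type},
    exists h : {freeg nat}, forall n, coeff n h = coeff (p.1, n) p.2.
  move=> [i c]; apply: (exists_freeg (s := [seq j.2 | j <- dom c])) => n /=.
  by rewrite -mem_dom => cn; apply/mapP; exists (i, n).
have /choice[F HF] : forall c : {freeg (I * nat)%type},
    exists d : {freeg I}, forall i, coeff i d = b i (B (i, c)).
  move=> c; apply: (exists_freeg (s := [seq j.1 | j <- dom c])) => i.
  apply: contraNT => ic; have -> : B (i, c) = 0; last by have [->] := Hb i.
  apply: freegP => n; rewrite HB coeff0; apply/eqP; apply: contraNT ic => /=.
  by rewrite -mem_dom => cn; apply/mapP; exists (i, n).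
have BE i c : (forall j, A j (coeff j c)) -> B (i, c) \in E i.
  by move=> Ac; rewrite inE => n; rewrite HB.
exists F; split=> [c d Ac Ad i|d].
  rewrite !HF; split=> [bcd n|cd].
    have [_ bI _] := Hb i.
    by rewrite -[LHS](HB (i, c)) (bI _ _ _ _ bcd) ?BE // HB.
  by congr (b i _); apply: freegP => n; rewrite !HB.
have /choice[h Hh] : forall i, exists h, E i h /\ b i h = coeff i d.
  by move=> i; have [_ _ /(_ (coeff i d))[h]] := Hb i; exists h.
have h0 i : coeff i d = 0 -> h i = 0.
  have [b0 bI _] := Hb i; have [Eh bh] := Hh i.
  by move=> di; apply: bI; rewrite ?inE // b0 bh.
have [j|c Hc] := @exists_freeg _ [seq (i, n) | i <- dom d, n <- dom (h i)]
    (fun j : I * nat => coeff j.2 (h j.1)).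
  case: j => i n /= hn; apply: allpairs_f_dep; rewrite mem_dom //.
  by apply: contraNneq hn => /h0->; rewrite coeff0.
have Ac j : A j (coeff j c) by rewrite Hc; case: j => i n; exact: (Hh i).1.
exists c => //; apply: freegP => i; rewrite HF.
have [_ <-] := Hh i; congr (b i _); apply: freegP => n.
by rewrite HB Hc.
Qed.

(** * Assembling the asymorphism *)

(** The ball of radius [A] around [x] consists of the [y] with [y - x] in
    [A `|` [set 0]], so that balls are controlled through differences. *)
Lemma prec_mapping_of_differences (K : Type) (G H : zmodType) (f : G -> H) :
  (forall A : set G, card_lt A [set: K] ->
    exists2 B : set H, card_lt B [set: K]
      & forall x y, (A `|` [set 0]) (x - y) -> B (f x - f y)) ->
  @prec_mapping (group_ballean K (Algebra.to_multiplicative G))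
    (group_ballean K (Algebra.to_multiplicative H)) f.
Proof.
move=> Hf [A ltA]; have [B ltB AB] := Hf A ltA.
exists (exist _ B ltB) => x _ [_ [a Aa <-] <-].
exists (f (a + x) - f x : H); last exact: (subrK (f x : H)).
by left; apply: AB; rewrite addrK.
Qed.

(** An element of the union is determined by a list containing it and its
    position there. *)
Lemma card_lt_indices (T : Type) (I : eqType) V (u : T -> seq I) (A : set T)
    (C : set V) :
  card_lt [set: nat] C -> card_lt A C ->
  card_lt [set i | exists2 x, A x & i \in u x] C.
Proof.
move=> ltC ltA.
apply: (@card_le_lt_trans _ _ _ _ (A `*` [set: nat])); last first.
  exact: card_lt_setX (card_lt_infinite ltC) ltA ltC.
apply/card_le_relP.
exists (fun i p => i \in u p.1 /\ index i (u p.1) = p.2); split.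
  by move=> i [x Ax iu]; exists (x, index i (u x)).
by move=> i j [x n] _ _ [iu <-] [ju]; move=> /= /esym; exact: index_inj.
Qed.

(** The operations [u i q] list the indices that closedness requires of a set
    containing [i].  A condition is indexed by [q = (n, k)]: it says that [k]
    times the generator [(i, n)], when it is a combination of earlier
    generators, is one with indices over [S]. *)
Lemma exists_coset_bijection (Gamma : choiceType) (G : zmodType) :
  card_lt [set: nat] [set: Gamma] -> [set: G] #= [set: Gamma] ->
  exists (f : G -> {freeg Gamma}) (e : Gamma * nat -> G)
      (u : Gamma -> nat * int -> seq Gamma),
    [/\ injective f, forall d, exists x, f x = d, forall x, span e setT x
      & forall S : set Gamma,
        (forall i q j, S i -> j \in u i q -> S j) ->
        forall x y, span e [set j | S j.1] (x - y) <->
                    supported S (f x - f y)].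
Proof.
move=> gamma_gt_aleph0 card_G.
have card_I : [set: Gamma * nat] #= [set: G].
  apply: card_eq_trans (card_prod_nat _) _; last by rewrite card_eq_sym.
  exact: card_lt_infinite gamma_gt_aleph0.
have G_gt_aleph0 : card_lt [set: nat] [set: G].
  have [N1 N2] := gamma_gt_aleph0.
  by split; rewrite ?(card_le_eqr card_G) ?(card_le_eql card_G).
have [lt [e [wo e_ind e_gen]]] := exists_independent_family G_gt_aleph0 card_I.
have [rem [rem0 rem_equiv rem_eq]] := exists_remainder lt e.
have /choice[nf Hnf] : forall x, exists c, normal rem c /\ combination e c = x.
  move=> x; have [c _ <-] := e_gen x.
  by have [d [dn dE _]] := exists_normal wo rem0 rem_equiv rem_eq c; exists d.
have nf_normal x : normal rem (nf x) by exact: (Hnf x).1.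
have nfK x : combination e (nf x) = x by exact: (Hnf x).2.
have [||F [F_eq F_surj]] :=
    @exists_regrouping Gamma (fun j => [set k | rem j k = k]).
- exact: rem0.
- move=> j; exists (rem j 1); first by apply/esym/rem_eq; exact: rem_equiv.
  apply/eqP => r1; apply: (e_ind j).
  by have := rem_equiv j 1; rewrite r1 subr0.
pose f x := F (nf x).
have f_eq x y i : coeff i (f x) = coeff i (f y) <->
    forall n, coeff (i, n) (nf x) = coeff (i, n) (nf y).
  by apply: F_eq; exact: nf_normal.
have f_inj : injective f.
  move=> x y fxy; rewrite -(nfK x) -(nfK y); congr combination.
  by apply: freegP => -[i n]; apply: (f_eq x y i).1; rewrite fxy.
have f_surj d : exists x, f x = d.
  have [c cn <-] := F_surj d; exists (combination e c).
  congr F; apply: (normal_unique wo rem_eq) => //; exact: nfK.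
(* [rel (j, k)] rewrites [k] times the generator [j] in earlier generators. *)
have /choice[rel Hrel] : forall p : (Gamma * nat) * int, exists c,
    order_ideal lt e p.1 p.2 ->
    supported (below lt p.1) c /\ combination e c = e p.1 *~ p.2.
  move=> [j k]; have [[c cj cE]|nN] := pselect (order_ideal lt e j k).
    by exists c.
  by exists 0.
exists f, e, (fun i q => [seq a.1 | a <- dom (rel ((i, q.1), q.2))]).
split=> // S Sclosed x y; split=> [xyS i|fxy].
- rewrite coeffB => fi; apply: contrapT => nSi; move: fi.
  rewrite (_ : coeff i (f x) = coeff i (f y)) ?subrr ?eqxx //.
  apply/f_eq => n; apply: (normal_coset (S := [set j | S j.1]) wo rem_eq) => //.
    move=> [i' m] k /= Si' N.
    have [relj relE] := Hrel ((i', m), k) N.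
    exists (rel ((i', m), k)) => // j jrel; split; last exact: relj.
    by apply: (Sclosed i' (m, k) j.1 Si'); apply: map_f; rewrite mem_dom.
  by rewrite !nfK.
- exists (nf x - nf y); last by rewrite raddfB /= !nfK.
  move=> [i n]; rewrite coeffB => nfi; apply: contrapT => /= nSi.
  have := coeff_outside fxy nSi; rewrite coeffB => /eqP; rewrite subr_eq0.
  by move=> /eqP/f_eq/(_ n) E; rewrite E subrr eqxx in nfi.
Qed.

Theorem theorem1 (Gamma : choiceType) (G : zmodType) (K : Type)
    (gamma_gt_aleph0 : card_lt [set: nat] [set: Gamma])
    (card_G : [set: G] #= [set: Gamma])
    (kappa_gt_aleph0 : card_lt [set: nat] [set: K])
    (kappa_le_gamma : [set: K] #<= [set: Gamma]) :
  kappa_asymorphic K (Algebra.to_multiplicative G) (Algebra.to_multiplicative {freeg Gamma}).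
Proof.
have [f [e [u [f_inj f_surj e_gen f_coset]]]] :=
  exists_coset_bijection gamma_gt_aleph0 card_G.
have /choice[g gK] := f_surj.
have fK : cancel f g by move=> x; apply: f_inj; rewrite gK.
have /choice[c Hc] : forall x, exists c, combination e c = x.
  by move=> x; have [c _ <-] := e_gen x; exists c.
exists f; exists g; split=> //.
- apply: prec_mapping_of_differences => A ltA.
  have [S [AS ltS Sclosed]] := card_lt_closure u kappa_gt_aleph0
    (card_lt_indices (fun x => [seq a.1 | a <- dom (c x)]) kappa_gt_aleph0 ltA).
  exists [set d | supported S d] => [|x y xyA]; first exact: card_lt_supported.
  apply/f_coset => //; case: xyA => [Axy|->]; last exact: span0.
  exists (c (x - y)); last exact: Hc.
  move=> i ci; apply: AS; exists (x - y) => //.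
  by apply: map_f; rewrite mem_dom.
- apply: prec_mapping_of_differences => B ltB.
  have [S [BS ltS Sclosed]] := card_lt_closure u kappa_gt_aleph0
    (card_lt_indices (fun d => dom d) kappa_gt_aleph0 ltB).
  exists (span e [set j | S j.1]) => [|x y xyB].
    apply: card_lt_image; apply: card_lt_supported => //.
    apply: (@card_le_lt_trans _ _ _ _ (S `*` [set: nat])).
      by apply: subset_card_le => -[].
    exact: card_lt_setX (card_lt_infinite _) _ _.
  apply/f_coset => //; rewrite !gK; case: xyB => [Bxy|->]; last exact: supported0.
  by move=> i xyi; apply: BS; exists (x - y) => //; rewrite mem_dom.
Qed.
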